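(* For every integer $d\geq 1$, there exists a $d$-regular vertex-transitive graph $G_d$ with $\chi_a(G_d)=\left\lceil \frac{d+3}{2}\right\rceil$.
   Context: All graphs are finite, simple and undirected. A $k$-acyclic colouring of $G$ is a function $f\colon V(G)\to\{0,\dots,k-1\}$ with $f(u)\neq f(v)$ for every edge $uv$ such that the union of any two colour classes induces a forest. The acyclic chromatic number $\chi_a(G)$ is the least $k$ such that $G$ admits a $k$-acyclic colouring. *)

(* Defs.v *)
From mathcomp Require Import all_boot all_fingroup.
From mathcomp Require Import boolp.

Set Implicit Arguments.
Unset Strict Implicit.
Unset Printing Implicit Defensive.

Record sgraph := SGraph {
  vertex :> finType;
  adj : rel vertex;
  adj_sym : symmetric adj;
  adj_irrefl : irreflexive adj }.

Definition regular (G : sgraph) (d : nat) : Prop :=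
  forall v : G, #|[set w | adj v w]| = d.

Definition automorphism (G : sgraph) (p : {perm G}) : Prop :=
  forall x y : G, adj (p x) (p y) = adj x y.

Definition vertex_transitive (G : sgraph) : Prop :=
  forall x y : G, exists2 p : {perm G}, automorphism p & p x = y.

Section Induced.
Variables (G : sgraph) (A : {set G}).

Definition induced_adj : rel {x : G | x \in A} :=
  fun x y => adj (val x) (val y).

Lemma induced_sym : symmetric induced_adj.
Proof. by move=> x y; apply: adj_sym. Qed.

Lemma induced_irrefl : irreflexive induced_adj.
Proof. by move=> x; apply: adj_irrefl. Qed.

Definition induced : sgraph := SGraph induced_sym induced_irrefl.
End Induced.

(* The size bound is needed: a single edge [:: x; y] satisfies ucycle. *)
Definition forest (G : sgraph) : Prop :=
  forall s : seq G, 2 < size s -> ~ ucycle (@adj G) s.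

Definition colour_class (G : sgraph) (k : nat) (f : G -> 'I_k) (i : 'I_k) :
  {set G} := [set v | f v == i].

Definition acyclic_colouring (G : sgraph) (k : nat) (f : G -> 'I_k) : Prop :=
  (forall u v : G, adj u v -> f u <> f v) /\
  (forall i j : 'I_k, i != j ->
     forest (induced (colour_class f i :|: colour_class f j))).

Definition acyclic_colourable (G : sgraph) (k : nat) : Prop :=
  exists f : G -> 'I_k, acyclic_colouring f.

Lemma acyclic_colourable_card (G : sgraph) : acyclic_colourable G #|G|.
Proof.
exists enum_rank; split=> [u v uv /enum_rank_inj euv|i j _ s s2 /andP[_ us]].
  by rewrite euv adj_irrefl in uv.
have := uniq_leq_size (s2 := [:: enum_val i; enum_val j]) (s1 := map val s).
rewrite (map_inj_uniq val_inj) us size_map => /(_ isT) szs.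
suff /szs /(leq_trans s2) : {subset map val s <= [:: enum_val i; enum_val j]}.
  by rewrite ltnn.
move=> _ /mapP[x _ ->]; move: (val x) (valP x) => y; rewrite !inE.
by case/orP=> /eqP <-; rewrite enum_rankK eqxx ?orbT.
Qed.

Lemma ex_acyclic_colourable (G : sgraph) :
  exists k, `[< acyclic_colourable G k >].
Proof. by exists #|G|; apply/asboolP; apply: acyclic_colourable_card. Qed.

Definition acyclic_chromatic_number (G : sgraph) : nat :=
  ex_minn (ex_acyclic_colourable G).

(* Main.v *)
(**
Lower bound: two colour classes of an acyclic colouring induce a forest, which
has fewer edges than vertices; summing over the pairs of classes of a
[d]-regular graph gives [d < 2 (k - 1)].

Upper bound: take as vertices the arcs of the complete digraph on [p + 2]
points, two arcs being adjacent when one starts where the other ends; opposite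
arcs are adjacent only if [d] is odd. The degree is [2 p], plus [1] for [d] odd.
Colour an arc by its tail. The arcs with tail [a] or [b] induce two stars, with
centres [(a, b)] and [(b, a)], whose centres are adjacent when [d] is odd.
Vertex-transitivity is the 2-transitivity of the symmetric group.
*)
Require Import Defs.
From mathcomp Require Import all_boot all_fingroup.
From mathcomp Require Import boolp zify.

Set Implicit Arguments.
Unset Strict Implicit.
Unset Printing Implicit Defensive.

(** * Cycles in induced subgraphs *)

(** Successor and predecessor of [x] on the cycle, read off after rotating [x] to the front; they
    differ because the length exceeds 2. *)
Lemma ucycle_neighbours (T : eqType) (e : rel T) (s : seq T) (x : T) :
  ucycle e s -> 2 < size s -> x \in s ->
  exists y z, [/\ y \in s, z \in s, y != z, e x y & e z x].
Proof.
move=> /andP[cs us] s2 /rot_to[i t st].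
have memt y : y \in t -> y \in s.
  by move=> yt; rewrite -(mem_rot i) st inE yt orbT.
move: cs us s2; rewrite -(rot_cycle i) -(rot_uniq i) -(size_rot i) st.
case: t memt {st} => [|y t] memt //=; case/lastP: t memt => [|t z] memt //=.
rewrite rcons_path last_rcons => /andP[exy /andP[_ ezx]].
move=> /and3P[_ + _] _; rewrite mem_rcons inE negb_or => /andP[nyz _].
exists y, z; split=> //; apply: memt; first exact: mem_head.
by rewrite inE mem_rcons mem_head orbT.
Qed.

(** Trades sequences over the subtype for sequences in [G] that stay inside [A]. *)
Lemma forest_inducedP (G : sgraph) (A : {set G}) :
  forest (induced A) <->
  (forall s : seq G, 2 < size s -> {subset s <= A} -> ~ ucycle (@adj G) s).
Proof.
split=> [fA s s2 sA|fA s s2 /andP[cs us]].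
  have [t st] : exists t : seq (induced A), s = map val t.
    elim: s sA {s2} => [|x s IHs] sA; first by exists [::].
    have [|t ->] := IHs; first by move=> y ys; rewrite sA // inE ys orbT.
    by exists (Sub x (sA x (mem_head _ _)) :: t).
  rewrite st in s2 *; rewrite size_map in s2.
  rewrite /ucycle map_inj_uniq; last exact: val_inj.
  move=> /andP[ct ut]; apply: (fA t s2).
  by rewrite /ucycle ut andbT; move: ct; rewrite cycle_map.
apply: (fA (map val s)); rewrite ?size_map //.
  by move=> _ /mapP[x _ ->]; apply: valP.
by rewrite /ucycle cycle_map map_inj_uniq ?us ?andbT //; apply: val_inj.
Qed.

(** * Edge counts of forests *)

Section EdgeCount.
Variable G : sgraph.
Implicit Types A B : {set G}.

(** Ordered pairs are counted, so [edge_count A A] is twice the number of edges inside [A]. *)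
Definition edge_count A B : nat := \sum_(x in A) \sum_(y in B) adj x y.

Lemma edge_countC A B : edge_count A B = edge_count B A.
Proof.
rewrite /edge_count exchange_big; apply: eq_bigr => y _.
by apply: eq_bigr => x _; rewrite adj_sym.
Qed.

Lemma edge_countUl A B D : [disjoint A & B] ->
  edge_count (A :|: B) D = edge_count A D + edge_count B D.
Proof.
move=> dAB; rewrite /edge_count -bigU //=.
by apply: eq_bigl => x; rewrite !inE.
Qed.

(* If every vertex had two neighbours in [A], every path in [A] could be
   extended without repeating a vertex. *)
Lemma forest_has_leaf A : A != set0 -> forest (induced A) ->
  exists2 x, x \in A & \sum_(y in A) adj x y <= 1.
Proof.
move=> /set0Pn[x0 x0A] /forest_inducedP fA.
have [/existsP[x /andP[xA dx]]|] :=
  boolP [exists x, (x \in A) && (\sum_(y in A) adj x y <= 1)]; first by exists x.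
rewrite negb_exists => /forallP noleaf; exfalso.
have nbr x z : x \in A -> exists y, [/\ y \in A, adj x y & y != z].
  move=> xA; have := noleaf x; rewrite xA /= -ltnNge => dx.
  have [/existsP[y /and3P[]]|] :=
    boolP [exists y, [&& y \in A, adj x y & y != z]]; first by exists y.
  rewrite negb_exists => /forallP nz; move: dx; rewrite ltnNge => /negP[].
  apply: (@leq_trans (\sum_(y in A) (y == z))).
    apply: leq_sum => y yA; have := nz y; rewrite yA /=.
    by case: (adj x y); case: (y == z).
  rewrite big_mkcond (bigD1 z) //= eqxx big1 => [|y /negPf->]; last by case: ifP.
  by rewrite addn0; case: ifP.
have long n : exists x p, [/\ size p = n, uniq (x :: p),
    path (@adj G) x p & {subset x :: p <= A}].
  elim: n => [|n [x [p [sp up pp pA]]]].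
    by exists x0, [::]; split=> // y; rewrite inE => /eqP->.
  (* The path grows at its front. The neighbour to avoid is the second vertex; for empty [p] the
     default [x] is harmless, as [adj] is irreflexive. *)
  have [y [yA xy yp]] := nbr x (head x p) (pA x (mem_head _ _)).
  have yx : y != x by apply: contraTneq xy => ->; rewrite adj_irrefl.
  case: (boolP (y \in p)) => [y_p|ynp].
    case: p y_p sp up pp pA yp => [//|z p] y_p _ up pp pA /= yz.
    move: y_p; rewrite inE (negPf yz) /= => y_p.
    (* Since [y] lies on the path beyond [z], the edge from [y] to [x] closes the initial segment
       into a cycle of length at least 3. *)
    exfalso; case/splitPr: y_p up pp pA => p1 p2 up pp pA.
    apply: (fA (x :: z :: rcons p1 y)).
    - by rewrite /= size_rcons.
    - move=> w ws; apply: pA; move: ws.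
      rewrite !inE mem_rcons mem_cat !inE.
      by do 2![case/orP=> [->|]; rewrite ?orbT //]; case/orP=> ->; rewrite !orbT.
    - move: up pp; rewrite -cat_rcons -!cat_cons cat_uniq cat_path /ucycle.
      case/andP=> -> _ /andP[pp _]; rewrite andbT.
      by rewrite /= rcons_path last_rcons [adj y x]adj_sym xy andbT.
  exists y, (x :: p); split=> /=; first by rewrite sp.
  - by move: up; rewrite /= inE (negPf yx) /= ynp.
  - by rewrite adj_sym xy.
  - by move=> w; rewrite inE => /orP[/eqP->//|/pA].
have [x [p [sp up _ _]]] := long #|G|.
have := max_card (mem (x :: p)).
by rewrite (card_uniqP up) /= sp ltnn.
Qed.

(** Induction by deleting a leaf, which lowers [edge_count A A] by at most 2 and [#|A|.*2] by
    exactly 2. *)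
Lemma forest_edge_count A : A != set0 -> forest (induced A) ->
  edge_count A A < #|A|.*2.
Proof.
move: {2}#|A| (leqnn #|A|) => n; elim: n A => [|n IHn] A.
  by rewrite leqn0 cards_eq0 => ->.
move=> An A0 fA; have [x xA dx] := forest_has_leaf A0 fA.
have sumA F : \sum_(y in A) F y = F x + \sum_(y in A :\ x) F y :> nat.
  rewrite (bigD1 x) //=; congr (_ + _); apply: eq_bigl => y.
  by rewrite !inE andbC.
have eA : edge_count A A =
    edge_count (A :\ x) (A :\ x) + (\sum_(y in A) adj x y).*2.
  rewrite /edge_count sumA [X in _ + X](_ : _ =
    \sum_(y in A :\ x) adj y x + edge_count (A :\ x) (A :\ x)); last first.
    by rewrite -big_split; apply: eq_bigr => y _; rewrite sumA.
  have -> : \sum_(y in A :\ x) adj y x = \sum_(y in A) adj x y.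
    by rewrite sumA adj_irrefl; apply: eq_bigr => y _; rewrite adj_sym.
  by rewrite /edge_count; lia.
have cA := cardsD1 x A; rewrite xA in cA.
(* The strict bound fails for the empty set, so a single vertex is the base case. *)
have [B0|B0] := eqVneq (A :\ x) set0.
  by rewrite eA cA sumA B0 /edge_count !big_set0 adj_irrefl; lia.
have fB : forest (induced (A :\ x)).
  apply/forest_inducedP => s s2 sB; apply: (forest_inducedP A).1 => // y /sB.
  by rewrite !inE => /andP[].
have := IHn (A :\ x) _ B0 fB; rewrite eA cA.
have Bn : #|A :\ x| <= n by rewrite cA in An.
by move=> /(_ Bn); lia.
Qed.
End EdgeCount.

(** * The lower bound on the number of colours *)

Lemma acyclic_colourable_regular (G : sgraph) (d k : nat) (x0 : G) :
  0 < d -> regular G d -> acyclic_colourable G k -> d < k.-1.*2.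
Proof.
move=> d0 rG [f [fP fF]].
pose C := colour_class f.
have indep i : edge_count (C i) (C i) = 0.
  rewrite /edge_count big1 // => x; rewrite inE => /eqP fx.
  rewrite big1 // => y; rewrite inE => /eqP fy.
  by case xy: (adj x y) => //; case: (fP _ _ xy); rewrite fx fy.
have disj i j : i != j -> [disjoint C i & C j].
  move=> ij; rewrite -setI_eq0; apply/eqP/setP => x; rewrite !inE.
  by apply: contraNF ij => /andP[/eqP<- /eqP<-].
(* Classes are independent, so all edges of the forest run between the two and its edge count is
   twice [edge_count (C i) (C j)]. *)
have edge_lt i j : i != j -> C i :|: C j != set0 ->
    edge_count (C i) (C j) < #|C i| + #|C j|.
  move=> ij U0; have := forest_edge_count U0 (fF i j ij).
  rewrite edge_countUl ?disj // !(edge_countC _ (_ :|: _)).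
  rewrite !edge_countUl ?disj // !indep (edge_countC (C j)).
  rewrite cardsU disjoint_setI0 ?disj // cards0; lia.
have sumC F : \sum_i \sum_(x in C i) F x = \sum_x F x :> nat.
  rewrite [RHS](partition_big f xpredT) //=; apply: eq_bigr => i _.
  by apply: eq_bigl => x; rewrite inE.
have total : \sum_i \sum_j edge_count (C i) (C j) = #|G| * d.
  rewrite -sum_nat_const -(sumC (fun=> d)); apply: eq_bigr => i _.
  rewrite exchange_big; apply: eq_bigr => x _; rewrite sumC -(rG x).
  by rewrite -sum1dep_card [RHS]big_mkcond.
have totalC : \sum_i \sum_(j | j != i) (#|C i| + #|C j|) = #|G| * k.-1.*2.
  have cC i : \sum_(j | j != i) #|C i| = #|C i| * k.-1.
    by rewrite sum_nat_const cardC1 card_ord mulnC.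
  have sC : \sum_i #|C i| = #|G|.
    by rewrite -sum1_card -sumC; apply: eq_bigr => i _; rewrite sum1_card.
  have half : \sum_i \sum_(j | j != i) #|C i| = #|G| * k.-1.
    by rewrite (eq_bigr _ (fun i _ => cC i)) -big_distrl sC.
  have half' : \sum_i \sum_(j | j != i) #|C j| = #|G| * k.-1.
    rewrite -half (exchange_big_dep xpredT) //=; apply: eq_bigr => i _.
    by apply: eq_bigl => j; rewrite eq_sym.
  under eq_bigr do rewrite big_split.
  by rewrite big_split /= half half' -mulnDr addnn.
(* Two empty classes give only equality; the edge from [x0] to [y0] supplies one pair of classes
   where the inequality is strict. *)
have [y0 xy0] : exists y, adj x0 y.
  have /card_gt0P[y] : 0 < #|[set w | adj x0 w]| by rewrite rG.
  by rewrite inE; exists y.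
have ij0 : f y0 != f x0 by apply/eqP => /esym; apply: fP.
suff : #|G| * d < #|G| * k.-1.*2 by rewrite ltn_mul2l => /andP[].
rewrite -total -totalC.
have -> : \sum_i \sum_j edge_count (C i) (C j) =
    \sum_i \sum_(j | j != i) edge_count (C i) (C j).
  by apply: eq_bigr => i _; rewrite (bigD1 i) //= indep.
have pairE F : \sum_i \sum_(j | j != i) F i j =
    F (f x0) (f y0) + \sum_(p : 'I_k * 'I_k |
      (p.2 != p.1) && (p != (f x0, f y0))) F p.1 p.2 :> nat.
  by rewrite pair_big_dep (bigD1 (f x0, f y0)).
rewrite !pairE -addSn leq_add //.
  apply: edge_lt; first by rewrite eq_sym.
  by apply/set0Pn; exists x0; rewrite !inE eqxx.
apply: leq_sum => -[i j] /= /andP[ji _].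
have [U0|U0] := eqVneq (C i :|: C j) set0; last first.
  by rewrite ltnW ?edge_lt // eq_sym.
move/eqP: U0; rewrite setU_eq0 => /andP[/eqP-> _].
by rewrite /edge_count big_set0.
Qed.

(** * The arc graphs *)

Definition arc n : finType := {x : 'I_n * 'I_n | x.1 != x.2}.

Definition arc_adj (opp : bool) n : rel (arc n) := fun x y =>
  let: (a, b) := val x in let: (c, d) := val y in
  ((b == c) || (d == a)) && (opp || ~~ ((b == c) && (d == a))).

Lemma arc_adj_sym opp n : symmetric (@arc_adj opp n).
Proof.
by move=> [[a b] ab] [[c d] cd]; rewrite /arc_adj /= orbC [(b == c) && _]andbC.
Qed.

Lemma arc_adj_irrefl opp n : irreflexive (@arc_adj opp n).
Proof.
by move=> [[a b] ab]; rewrite /arc_adj /= orbb eq_sym (negPf ab).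
Qed.

Definition arc_graph opp n : sgraph :=
  SGraph (@arc_adj_sym opp n) (@arc_adj_irrefl opp n).

(** With [D] the points other than [a] and [b], the neighbours of [(a, b)] form disjoint families:
    [p] arcs out of [b], [p] arcs into [a], and [(b, a)] when [opp] holds. *)
Lemma arc_graph_regular opp p : regular (arc_graph opp p.+2) (opp + p.*2).
Proof.
move=> x; case xE: x => [[a b] abP]; rewrite -xE; have /= ab := abP.
pose D := ~: [set a; b].
have cD : #|D| = p.
  by have := cardsC [set a; b]; rewrite cards2 ab card_ord -/D; lia.
have injl : injective (fun k : 'I_p.+2 => (b, k)) by move=> k l [].
have injr : injective (fun k : 'I_p.+2 => (k, a)) by move=> k l [].
rewrite -(card_imset _ val_inj).
have -> : val @: [set w : arc_graph opp p.+2 | adj x w] =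
    [set (b, k) | k in D] :|: [set (k, a) | k in D]
      :|: (if opp then [set (b, a)] else set0).
  apply/setP => -[c d]; rewrite !inE.
  have -> : ((c, d) \in [set (b, k) | k in D]) = (c == b) && (d \in D).
    apply/imsetP/andP => [[k kD [-> ->]]|[/eqP-> dD]]; first by rewrite eqxx.
    by exists d.
  have -> : ((c, d) \in [set (k, a) | k in D]) = (d == a) && (c \in D).
    apply/imsetP/andP => [[k kD [-> ->]]|[/eqP-> dD]]; first by rewrite eqxx.
    by exists c.
  have -> : ((c, d) \in (if opp then [set (b, a)] else set0)) =
      [&& opp, c == b & d == a].
    by case: (opp); rewrite !inE ?xpair_eqE.
  have -> : ((c, d) \in val @: [set w : arc_graph opp p.+2 | adj x w])
     = (c != d) && (((b == c) || (d == a)) && (opp || ~~ ((b == c) && (d == a)))).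
    apply/imsetP/andP => [[[[c' d'] cd']]|[cd e]].
      by rewrite inE xE => e [-> ->].
    by exists (exist _ (c, d) cd); rewrite ?inE ?xE.
  rewrite !inE !negb_or (eq_sym b c).
  have [->|cb] := eqVneq c b; have [->|da] := eqVneq d a => //=.
  - by rewrite eq_sym ab orbF andbF andbT.
  - by rewrite orbT andbT andbF !orbF eq_sym.
  - by rewrite orbT !andbT andbF orbF.
  by rewrite !andbF.
have LR : [set (b, k) | k in D] :&: [set (k, a) | k in D] = set0.
  apply/setP => q; rewrite !inE; apply/andP => -[/imsetP[k kD ->] /imsetP[l _ []]].
  by move=> _ ka; rewrite ka !inE eqxx in kD.
have LRO : ([set (b, k) | k in D] :|: [set (k, a) | k in D])
    :&: (if opp then [set (b, a)] else set0) = set0.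
  case: (opp); last by rewrite setI0.
  apply/setP => q; rewrite !inE; apply/andP => -[qLR /eqP qO].
  case/orP: qLR => /imsetP[k kD]; rewrite qO => -[e].
    by rewrite -e !inE eqxx in kD.
  by rewrite -e !inE eqxx orbT in kD.
rewrite !cardsU LR LRO cards0 !card_imset // cD !subn0 addnn addnC.
by case: (opp); rewrite ?cards1 ?cards0.
Qed.

Lemma arc_graph_transitive opp n : vertex_transitive (arc_graph opp n).
Proof.
move=> [[a b] /= ab] [[c d] /= cd].
have inj2 (s : {perm 'I_n}) (x : arc n) : s (val x).1 != s (val x).2.
  by rewrite (inj_eq perm_inj); apply: valP x.
pose g (s : {perm 'I_n}) (x : arc n) : arc n :=
  exist _ (s (val x).1, s (val x).2) (inj2 s x).
have g_inj s : injective (g s).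
  move=> [[x1 x2] xP] [[y1 y2] yP] /(congr1 val)[/perm_inj e1 /perm_inj e2].
  by apply: val_inj; rewrite /= e1 e2.
(* The left factor acts first, sending [a] to [c]; the second moves the image of [b] to [d] and
   fixes [c]. *)
pose s := (tperm a c * tperm (tperm a c b) d)%g.
exists (perm (g_inj s)).
  move=> [[x1 x2] xP] [[y1 y2] yP]; rewrite !permE /= /arc_adj /=.
  by rewrite !(inj_eq perm_inj).
rewrite permE; apply: val_inj => /=; rewrite !permM tpermL; congr (_, _).
  rewrite [LHS]tpermD 1?[d == c]eq_sym //.
  by rewrite -[X in _ != X](tpermL a c) (inj_eq perm_inj) eq_sym.
by rewrite tpermL.
Qed.

(** Among the arcs with tail [a] or [b], all but the two centres have at most one neighbour, so a
    cycle would have at most two vertices. *)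
Lemma arc_graph_colourable opp n : acyclic_colourable (arc_graph opp n) n.
Proof.
exists (fun x : arc n => (val x).1); split.
  move=> [[a b] ab] [[c d] cd] /= /andP[/orP[/eqP<-|/eqP<-] _]; apply/eqP => //.
  by rewrite eq_sym.
move=> a b ab; apply/forest_inducedP => s s2 sA cs.
have centre x : x \in s -> val x \in [:: (a, b); (b, a)].
  move=> xs; have [y [z [ys zs yz]]] := ucycle_neighbours cs s2 xs.
  rewrite (adj_sym z); move: (sA x xs) (sA y ys) (sA z zs) yz.
  case: x y z {xs ys zs} => [[x1 x2] /= xP] [[y1 y2] /= yP] [[z1 z2] /= zP].
  rewrite -(inj_eq val_inj) /= !inE /= /arc_adj /= !xpair_eqE => hx hy hz + /andP[xy _] /andP[xz _].
  apply: contraR; rewrite negb_or => /andP[nab nba].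
  have [x2a x2b] : x2 != a /\ x2 != b.
    split; [apply: contraNneq nba|apply: contraNneq nab] => e; move: xP hx;
      by rewrite e eqxx andbT => /negPf->; rewrite ?orbF.
  (* The head [x2] is no tail in these classes, so both neighbours end at [x1] and start at the
     other one of [a] and [b]: they coincide. *)
  have tail2 y : (y == a) || (y == b) -> (x2 == y) = false.
    by case/orP=> /eqP->; apply/negbTE.
  rewrite !tail2 //= in xy xz; rewrite (eqP xy) (eqP xz) in yP zP *.
  rewrite eqxx andbT; move: hx hy hz yP zP.
  by do 3![case/orP=> /eqP->]; rewrite ?eqxx.
have := uniq_leq_size (s1 := map val s) (s2 := [:: (a, b); (b, a)]).
rewrite map_inj_uniq ?size_map; last exact: val_inj.
case/andP: cs => _ -> /(_ isT) szs.
by have := leq_trans s2 (szs _); rewrite ltnn => /(_ _)/negP[] // _ /mapP[x /centre ? ->].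
Qed.

Theorem theorem3 (d : nat) (hd : 1 <= d) :
  exists G : sgraph,
    [/\ regular G d, vertex_transitive G
      & acyclic_chromatic_number G = uphalf (d + 3)].
Proof.
(* With [d./2 + 2] points the degree is [odd d + (d./2).*2 = d], and the number of points equals
   [uphalf (d + 3)]. *)
pose G := arc_graph (odd d) d./2.+2.
have rG : regular G d by rewrite -[X in regular _ X](odd_double_half d); apply: arc_graph_regular.
exists G; split=> //; first exact: arc_graph_transitive.
rewrite addn3 /acyclic_chromatic_number; case: ex_minnP => k /asboolP ck mink.
apply/eqP; rewrite eqn_leq mink; last exact/asboolP/arc_graph_colourable.
have x0 : G by apply: (Sub (ord0, ord_max)).
have := acyclic_colourable_regular x0 hd rG ck.
rewrite /=; lia.
Qed.
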